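(* Let $A\in\mathbb{R}_{\geq 0}^{m\times n}$ and $b\in\mathbb{R}_{\geq 0}^{m}$, and consider the LP $\min\{\|x\|_1\mid Ax\geq b,\ x\geq 0\}$ with optimal value $\mathit{LIN}>0$. Let $\delta>0$, $\alpha>0$, and let $x'$ be a feasible solution with $\|x'\|_1\leq(1+\delta)\mathit{LIN}$ and $\|x'\|_1\geq 2\alpha(1/\delta+1)$. Define $x^{var}=\frac{2\alpha(1/\delta+1)}{\|x'\|_1}x'$, $x^{fix}=x'-x^{var}$, $b^{var}=b-Ax^{fix}$. Let $\hat{x}$ be any feasible solution of the LP $\min\{\|x\|_1\mid Ax\geq b^{var},\ x\geq 0\}$ whose value is at most $(1+\delta/2)$ times the optimal value of that LP. If $\|x^{fix}+\hat{x}\|_1<\|x'\|_1$ set $x''=x^{fix}+\hat{x}$, otherwise set $x''=x'$. Then $x''$ is a feasible solution of the original LP with $\|x''\|_1\leq(1+\delta)\mathit{LIN}-\alpha$ and $\|x''-x'\|_1\leq 4\alpha(1/\delta+1)$.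
   Context: $\|\cdot\|_1$ is the $\ell_1$-norm. The construction of $x''$ in the claim is the paper's ''Algorithm 2''. *)

(* Defs.v *)
From HB Require Import structures.
From mathcomp Require Import all_boot all_order all_algebra.
From mathcomp Require Import boolp classical_sets reals.

Set Implicit Arguments.
Unset Strict Implicit.
Unset Printing Implicit Defensive.

Import Order.TTheory GRing.Theory Num.Theory.

Local Open Scope classical_set_scope.
Local Open Scope ring_scope.

Definition norm1 (R : realType) (n : nat) (x : 'cV[R]_n) : R :=
  \sum_(j < n) `|x j 0|.

Definition lp_feasible (R : realType) (m n : nat)
    (A : 'M[R]_(m, n)) (b : 'cV[R]_m) : set 'cV[R]_n :=
  [set x | (forall i : 'I_m, b i 0 <= (A *m x) i 0)
        /\ (forall j : 'I_n, 0 <= x j 0)].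

(* The minimum is attained by definition; for a feasible LP this is no
   restriction, since its objective is bounded below by 0. *)
Definition lp_optimal_value (R : realType) (m n : nat)
    (A : 'M[R]_(m, n)) (b : 'cV[R]_m) (v : R) : Prop :=
  let values := [set norm1 x | x in lp_feasible A b] in
  values v /\ lbound values v.

(* Main.v *)
(** Put K = 2 alpha (1/delta + 1) and c = K / |x'|, so that x^fix = (1 - c) x'.
    Scaling an optimal solution of the original LP by c gives a feasible
    solution of the residual LP, because b - (1 - c) A x' <= c b; hence
    |x^fix + xhat| <= (1 - c) |x'| + (1 + delta/2) c LIN
                   <= (1 + delta) LIN - c (delta/2) LIN,
    and c (delta/2) LIN = alpha (1 + delta) LIN / |x'| >= alpha.
    For the distance: if xhat is used, then |xhat| < K, and
    |xhat - x^var| <= |xhat| + |x^var| < 2 K. *)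

Require Import Defs.
From HB Require Import structures.
From mathcomp Require Import all_boot all_order all_algebra.
From mathcomp Require Import boolp classical_sets reals.
From mathcomp Require Import ring lra.

Set Implicit Arguments.
Unset Strict Implicit.
Unset Printing Implicit Defensive.

Import Order.TTheory GRing.Theory Num.Theory.

Local Open Scope classical_set_scope.
Local Open Scope ring_scope.

Lemma norm1Z (R : realType) (n : nat) (c : R) (x : 'cV[R]_n) :
  norm1 (c *: x) = `|c| * norm1 x.
Proof. by rewrite /norm1 mulr_sumr; apply: eq_bigr => j _; rewrite mxE normrM. Qed.

Lemma ler_norm1B (R : realType) (n : nat) (x y : 'cV[R]_n) :
  norm1 (x - y) <= norm1 x + norm1 y.
Proof.
by rewrite /norm1 -big_split /=; apply: ler_sum => j _; rewrite !mxE ler_normB.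
Qed.

(** Equality, rather than the triangle inequality, is what lets the test on |xfix + xhat| be turned
    into a bound on |xhat|. *)
Lemma norm1D_ge0 (R : realType) (n : nat) (x y : 'cV[R]_n) :
  (forall j, 0 <= x j 0) -> (forall j, 0 <= y j 0) ->
  norm1 (x + y) = norm1 x + norm1 y.
Proof.
move=> x0 y0; rewrite /norm1 -big_split /=; apply: eq_bigr => j _.
by rewrite mxE !ger0_norm ?addr_ge0.
Qed.

Lemma lp_feasibleD (R : realType) (m n : nat) (A : 'M[R]_(m, n))
    (b : 'cV[R]_m) (x y : 'cV[R]_n) :
  (forall j, 0 <= x j 0) -> lp_feasible A (b - A *m x) y ->
  lp_feasible A b (x + y).
Proof.
move=> x0 [Ay y0]; split=> [i|j]; last by rewrite mxE addr_ge0.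
by have := Ay i; rewrite mulmxDr !mxE lerBlDl.
Qed.

(** Row by row, add [1 - c] times the constraint at [x] to [c] times the constraint at [y]. It is
    applied with [x'] as [x] and an optimal solution as [y]. *)
Lemma lp_feasible_scale (R : realType) (m n : nat) (A : 'M[R]_(m, n))
    (b : 'cV[R]_m) (c : R) (x y : 'cV[R]_n) :
  0 <= c <= 1 -> lp_feasible A b x -> lp_feasible A b y ->
  lp_feasible A (b - A *m ((1 - c) *: x)) (c *: y).
Proof.
move=> /andP[c0 c1] [Ax x0] [Ay y0]; split=> [i|j]; last by rewrite mxE mulr_ge0.
rewrite -!scalemxAr.
have := Ax i; have := Ay i.
move: (A *m x) (A *m y) => u v bv bu; rewrite !mxE.
have := ler_wpM2l c0 bv.
have c1' : 0 <= 1 - c by rewrite subr_ge0.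
have := ler_wpM2l c1' bu; lra.
Qed.

Theorem theorem4 (R : realType) (m n : nat)
    (A : 'M[R]_(m, n)) (b : 'cV[R]_m) (LIN delta alpha : R)
    (x' xhat : 'cV[R]_n) :
  (forall i j, 0 <= A i j) ->
  (forall i, 0 <= b i 0) ->
  lp_optimal_value A b LIN ->
  0 < LIN ->
  0 < delta ->
  0 < alpha ->
  lp_feasible A b x' ->
  norm1 x' <= (1 + delta) * LIN ->
  2 * alpha * (1 / delta + 1) <= norm1 x' ->
  let xvar := (2 * alpha * (1 / delta + 1) / norm1 x') *: x' in
  let xfix := x' - xvar in
  let bvar := b - A *m xfix in
  lp_feasible A bvar xhat ->
  (exists2 OPT, lp_optimal_value A bvar OPT
              & norm1 xhat <= (1 + delta / 2) * OPT) ->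
  let x'' := if norm1 (xfix + xhat) < norm1 x' then xfix + xhat else x' in
  [/\ lp_feasible A b x'',
      norm1 x'' <= (1 + delta) * LIN - alpha
    & norm1 (x'' - x') <= 4 * alpha * (1 / delta + 1)].
Proof.
move=> _ _ [[xopt fopt nopt] _] LIN0 d0 a0 fx' nx' Kx' xvar xfix bvar fhat.
move=> [OPT [_ OPTle] nhat] x''.
pose K := 2 * alpha * (1 / delta + 1).
have K0 : 0 < K by rewrite /K mulr_gt0 ?mulr_gt0 ?addr_gt0 ?divr_gt0.
have N0 : 0 < norm1 x' := lt_le_trans K0 Kx'.
pose c := K / norm1 x'.
have c0 : 0 <= c by rewrite divr_ge0 // ltW.
have c1 : c <= 1 by rewrite ler_pdivrMr // mul1r.
have c1' : 0 <= 1 - c by rewrite subr_ge0.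
have cN : c * norm1 x' = K by rewrite divfK ?gt_eqF.
have xfixE : xfix = (1 - c) *: x' by rewrite scalerBl scale1r.
have xfix0 j : 0 <= xfix j 0 by rewrite xfixE mxE mulr_ge0 //; case: fx'.
have nfix : norm1 xfix = (1 - c) * norm1 x' by rewrite xfixE norm1Z ger0_norm.
have nvar : norm1 xvar = K by rewrite norm1Z ger0_norm.
have nsum : norm1 (xfix + xhat) = (1 - c) * norm1 x' + norm1 xhat.
  by rewrite norm1D_ge0 ?nfix //; case: fhat.
have OPTc : OPT <= c * LIN.
  apply: OPTle; exists (c *: xopt); last by rewrite norm1Z ger0_norm ?nopt.
  by rewrite /bvar xfixE; apply: lp_feasible_scale => //; apply/andP.
have gain : alpha <= c * (delta / 2) * LIN.
  (* The choice of [K] makes K delta / 2 = alpha (1 + delta). *)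
  have -> : c * (delta / 2) * LIN = alpha * ((1 + delta) * LIN) / norm1 x'.
    by rewrite /c /K; field; rewrite !gt_eqF.
  by rewrite ler_pdivlMr // ler_wpM2l // ltW.
have nsum_le : norm1 (xfix + xhat) <= (1 + delta) * LIN - alpha.
  have d2 : 0 <= 1 + delta / 2 by lra.
  (* With these two products given, the goal is linear in the monomials; the slack c LIN ((1 +
     delta) - (1 + delta/2)) is the left side of [gain]. *)
  have := ler_wpM2l d2 OPTc; have := ler_wpM2l c1' nx'.
  rewrite nsum; lra.
rewrite /x''; case: ltP => [lt_N|ge_N]; split=> //.
- exact: lp_feasibleD.
- have -> : xfix + xhat - x' = xhat - xvar.
    by rewrite /xfix addrC !addrA addNr add0r addrC.
  apply: le_trans (ler_norm1B _ _) _; rewrite nvar.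
  (* Cancelling (1 - c) |x'| in [lt_N] leaves |xhat| < c |x'| = K. *)
  by move: lt_N; rewrite nsum /K in cN *; lra.
(* When [x'] is kept, [ge_N] bounds its norm by that of the rejected candidate, for which [nsum_le]
   holds regardless of the test. *)
- exact: le_trans nsum_le.
- rewrite subrr -(scale0r x') norm1Z normr0 mul0r.
  by move: K0; rewrite /K; lra.
Qed.
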